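(* Let $M\in\mathbb{R}^{K\times K}$ be a positive semi-definite matrix parameter whose columns span the $L$-dimensional central subspace $\mathcal{S}_{y|f}$, where $L$ is fixed and $K$ may vary with the sample size $T\to\infty$, and let $\widehat M$ be its (symmetric) sample estimator. Let $\lambda_1\ge\dots\ge\lambda_K$ and $\widehat\lambda_1\ge\dots\ge\widehat\lambda_K$ be the eigenvalues of $M$ and $\widehat M$, respectively (so that $\lambda_L>0$). Fix a constant $c\in(0,1)$, let $K_c$ be the nearest integer to $cK$, assumed to be an upper bound of $L$, let $\tau$ be the number of positive $\widehat\lambda_i$'s, and define $G:\{1,\dots,K_c\}\to\mathbb{R}$ by $$G(l)=\frac T2\sum_{i=1+\min(\tau,l)}^{K_c}\{\log(\widehat\lambda_i+1)-\widehat\lambda_i\}-C_T\,\frac{l(2K-l+1)}{2}.$$ Let $\widehat L$ be the maximizer of $G$. Suppose $\|\widehat M-M\|=o_P(1)$. If $C_T$ satisfies $C_TKT^{-1}\to0$ and $\|\widehat M-M\|^2=o_P(C_TKT^{-1})$, then $\widehat L$ converges to $L$ in probability.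
   Context: $\|\cdot\|$ denotes the spectral norm, $\|A\|=\lambda_{\max}^{1/2}(A'A)$. $C_T$ is a sequence of positive numbers. The central subspace $\mathcal{S}_{y|f}\subseteq\mathbb{R}^K$ of a response $y_{t+1}$ on factors $f_t\in\mathbb{R}^K$ is the smallest subspace, spanned by say $\phi_1,\dots,\phi_L$, such that $y_{t+1}$ is independent of $f_t$ given $(\phi_1,\dots,\phi_L)'f_t$; its dimension is $L\ge1$. An empty sum is zero.
   Formalization: The condition λ_L > 0 is strengthened to a positive lower bound on λ_L that is uniform in T; when M varies with T the claim fails without it (e.g. nonzero eigenvalues 1 and 1/T with the estimator equal to M). *)

(* Defs.v *)
From HB Require Import structures.
From mathcomp Require Import all_boot all_order all_algebra.
From mathcomp Require Import all_classical all_reals all_analysis.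
Set Implicit Arguments.
Unset Strict Implicit.
Unset Printing Implicit Defensive.
Import Order.TTheory GRing.Theory Num.Theory.
Import numFieldNormedType.Exports.
Local Open Scope classical_set_scope.
Local Open Scope ring_scope.

(* For a symmetric real matrix exactly one sequence satisfies this. *)
Definition is_spectrum (R : realType) (K : nat) (A : 'M[R]_K) (s : seq R) :=
  sorted >=%R s /\ char_poly A = \prod_(a <- s) ('X - a%:P).

(* [::] is a junk value, reached only when char_poly A does not split over R;
   for a symmetric A the result is the decreasing list of its K eigenvalues. *)
Definition eigenvalues (R : realType) (K : nat) (A : 'M[R]_K) : seq R :=
  xget [::] (is_spectrum A).

(* Numbered from 1, so that eigval A 1 is the largest eigenvalue. *)
Definition eigval (R : realType) (K : nat) (A : 'M[R]_K) (i : nat) : R :=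
  (eigenvalues A)`_i.-1.

Definition spectral_norm (R : realType) (K : nat) (A : 'M[R]_K) : R :=
  Num.sqrt (eigval (A^T *m A) 1).

Definition psd (R : realType) (K : nat) (A : 'M[R]_K) :=
  A^T = A /\ forall x : 'cV[R]_K, 0 <= (x^T *m A *m x) 0 0.

Definition col_span (R : realType) (K q : nat) (A : 'M[R]_(K, q)) :
  {vspace 'cV[R]_K} := <<[seq col j A | j : 'I_q]>>%VS.

(* h is a version of P(A | H), for a sub-sigma-algebra H. *)
Definition is_cond_prob (R : realType) (d : measure_display)
    (Omega : measurableType d) (P : probability Omega R)
    (H : set_system Omega) (A : set Omega) (h : Omega -> R) :=
  [/\ forall B : set R, measurable B -> H (h @^-1` B),
      P.-integrable setT (EFin \o h) &
      forall C, H C -> (\int[P]_(w in C) (h w)%:E = P (A `&` C))%E].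

(* P(A n B | H) = P(A | H) P(B | H) a.s. for all A in G1, B in G2; versions
   exist by Radon-Nikodym, and the choice of versions is immaterial. *)
Definition cond_indep (R : realType) (d : measure_display)
    (Omega : measurableType d) (P : probability Omega R)
    (G1 G2 H : set_system Omega) :=
  forall A B, G1 A -> G2 B -> exists hA hB : Omega -> R,
    [/\ is_cond_prob P H A hA, is_cond_prob P H B hB &
        is_cond_prob P H (A `&` B) (hA \* hB)].

Definition sigma_vec (R : realType) (d : measure_display)
    (Omega : measurableType d) (q : nat) (Z : Omega -> 'cV[R]_q) :
  set_system Omega := g_sigma_preimage (fun (i : 'I_q) w => Z w i 0).

(* S is spanned by the columns phi_1, ..., phi_q of some Phi such that y is
   independent of f given (phi_1, ..., phi_q)' f. *)
Definition reduction_subspace (R : realType) (d : measure_display)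
    (Omega : measurableType d) (P : probability Omega R) (K : nat)
    (y : Omega -> R) (f : Omega -> 'cV[R]_K) (S : {vspace 'cV[R]_K}) :=
  exists (q : nat) (Phi : 'M[R]_(K, q)),
    col_span Phi = S /\
    cond_indep P (g_sigma_algebra_preimage y) (sigma_vec f)
      (sigma_vec (fun w => Phi^T *m f w)).

Definition central_subspace (R : realType) (d : measure_display)
    (Omega : measurableType d) (P : probability Omega R) (K : nat)
    (y : Omega -> R) (f : Omega -> 'cV[R]_K) (S : {vspace 'cV[R]_K}) :=
  reduction_subspace P y f S /\
  forall S' : {vspace 'cV[R]_K}, reduction_subspace P y f S' -> (S <= S')%VS.

Definition cvg_in_prob (R : realType) (d : measure_display)
    (Omega : measurableType d) (P : probability Omega R)
    (X : nat -> Omega -> R) (x : R) :=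
  forall eps : R, 0 < eps ->
    (fun n => P [set w | eps < `|X n w - x|]) @ \oo --> 0%E.

Definition oP (R : realType) (d : measure_display)
    (Omega : measurableType d) (P : probability Omega R)
    (X : nat -> Omega -> R) (a : nat -> R) :=
  cvg_in_prob P (fun n w => X n w / a n) 0.

(* Either neighbour is allowed when x is a half-integer. *)
Definition nearest_integer (R : realType) (x : R) (k : nat) :=
  forall m : int, `|k%:R - x| <= `|m%:~R - x|.

Definition num_pos_eigval (R : realType) (K : nat) (A : 'M[R]_K) : nat :=
  count (fun a => 0 < a) (eigenvalues A).

(* ln a = 0 by convention for a <= 0, which covers eigenvalues <= -1. *)
Definition criterion (R : realType) (T K Kc : nat) (C : R) (A : 'M[R]_K)
    (l : nat) : R :=
  T%:R / 2 *
    (\sum_((1 + minn (num_pos_eigval A) l)%N <= i < Kc.+1)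
        (ln (eigval A i + 1) - eigval A i))
  - C * (l%:R * (2 * K%:R - l%:R + 1) / 2).

Definition is_maximizer (R : realType) (n : nat) (G : nat -> R) (l : nat) :=
  (1 <= l <= n)%N /\ forall k : nat, (1 <= k <= n)%N -> G k <= G l.

(* Main.v *)
(* On the event where delta = ||Mhat - M|| is at most lambda / 2 and delta^2 is
   at most (1 - c) C K / T, the criterion G is maximal at L only.  By Weyl's
   inequality the first L eigenvalues of Mhat are at least lambda / 2, so for
   l < L the sum in G(L) - G(l) gains a fixed amount per index, which dominates
   the penalty because C K / T -> 0.  As M has rank L, the positive eigenvalues
   of Mhat beyond the L-th are at most delta, and ln (1 + x) - x >= - x^2; for
   l > L the sum then loses at most delta^2 per index, while the penalty gains
   at least C (1 - c) K per index, since l and L are at most K_c <= c K + 1/2.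

   To bound the probability of the complement one also needs delta to be
   measurable: the largest eigenvalue of a symmetric matrix A is at most a iff
   all coefficients of the characteristic polynomial of A - a are nonnegative.
   *)

Require Import Defs.
From HB Require Import structures.
From mathcomp Require Import all_boot all_order all_algebra.
From mathcomp Require Import all_classical all_reals all_analysis.
From mathcomp Require Import measurable_realfun.
From mathcomp Require Import perm complex ring lra zify.
Import Order.TTheory GRing.Theory Num.Theory.
Import numFieldNormedType.Exports.
Local Open Scope classical_set_scope.
Local Open Scope ring_scope.

Set Implicit Arguments.
Unset Strict Implicit.
Unset Printing Implicit Defensive.

(** * Similarity and Hermitian forms *)

Lemma char_poly_conj (F : fieldType) n (P A : 'M[F]_n) : P \in unitmx ->
  char_poly (invmx P *m A *m P) = char_poly A.
Proof.
move=> Pu; rewrite /char_poly.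
have -> : char_poly_mx (invmx P *m A *m P) =
    map_mx polyC (invmx P) *m char_poly_mx A *m map_mx polyC P.
  rewrite /char_poly_mx mulmxBr mulmxBl !map_mxM; congr (_ - _).
  by rewrite mul_mx_scalar -scalemxAl -map_mxM mulVmx// map_scalar_mx scalemx1.
rewrite !det_mulmx mulrAC -det_mulmx -map_mxM mulVmx //.
by rewrite map_scalar_mx det1 mul1r.
Qed.

Section Hermitian.
Local Open Scope sesquilinear_scope.
Variable C : numClosedFieldType.

Local Notation "''[' u , v ]" := (dotmx u v) : ring_scope.
Local Notation "''[' u ]" := '[u, u] : ring_scope.

Lemma trmxC_mul m n p (A : 'M[C]_(m, n)) (B : 'M[C]_(n, p)) :
  (A *m B) ^t* = B ^t* *m A ^t*.
Proof. by rewrite trmx_mul map_mxM. Qed.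

Lemma rowsub_unitarymx n k (e : 'I_k -> 'I_n) (P : 'M[C]_n) :
  injective e -> P \is unitarymx -> rowsub e P \is unitarymx.
Proof.
move=> einj /unitarymxP PP; apply/unitarymxP/matrixP => i j.
have /matrixP/(_ (e i) (e j)) := PP; rewrite !mxE (inj_eq einj) => <-.
by apply: eq_bigr => l _; rewrite !mxE.
Qed.

Lemma dotmx_mul n m (u : 'rV[C]_m) (U : 'M[C]_(m, n)) (v : 'rV[C]_n) :
  '[u *m U, v] = '[u, v *m U ^t*].
Proof. by rewrite !dotmxE trmxC_mul trmxCK mulmxA. Qed.

Lemma dotmx_unitary n m (u : 'rV[C]_m) (U : 'M[C]_(m, n)) :
  U \is unitarymx -> '[u *m U] = '[u].
Proof. by move=> /unitarymxP Uu; rewrite dotmx_mul -mulmxA Uu mulmx1. Qed.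

Lemma dotmx_normE n (u : 'rV[C]_n) : '[u] = \sum_j u 0 j * (u 0 j)^*.
Proof. by rewrite dotmxE mxE; apply: eq_bigr => j _; rewrite !mxE. Qed.

Lemma dotmx_compression n (A : 'M[C]_n) k (U : 'M[C]_(k, n)) d u :
  U *m A *m U ^t* = diag_mx d ->
  '[u *m U *m A, u *m U] = \sum_j d 0 j * (u 0 j * (u 0 j)^*).
Proof.
move=> Ud; rewrite dotmxE trmxC_mul !mulmxA -mulmxA -[_ *m A]mulmxA.
rewrite -2!mulmxA [U *m _]mulmxA [U *m _ *m _]mulmxA Ud mulmxA.
rewrite mul_mx_diag mxE; apply: eq_bigr => j _.
by rewrite !mxE mulrAC mulrC.
Qed.

(** Cauchy-Schwarz in disguise: the squared norm of [r *: x - x *m D] is nonnegative and, by the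
    hypothesis, at most [2 * r] times the difference of the two sides. For [r = 0] the hypothesis
    forces [x *m D = 0]. *)
Lemma dotmx_hermitian_le n (D : 'M[C]_n) (r : C) (x : 'rV[C]_n) :
  D ^t* = D -> 0 <= r -> '[x *m D] <= r ^+ 2 * '[x] ->
  '[x *m D, x] <= r * '[x].
Proof.
move=> hD r_ge0 nD.
have hx : '[x, x *m D] = '[x *m D, x] by rewrite dotmx_mul hD.
have [r_eq0|rN0] := eqVneq r 0.
  move: nD; rewrite r_eq0 expr0n /= !mul0r => xD.
  suff -> : x *m D = 0 by rewrite linear0l.
  by apply/eqP; rewrite -(dnorm_eq0 (@dotmx _ n)) eq_le xD dnorm_ge0.
have r_gt0 : 0 < r by rewrite lt_neqAle eq_sym rN0.
have := dnorm_ge0 (@dotmx _ n) (r *: x - x *m D).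
rewrite linearBl /= !linearBr /= !linearZl_LR /= !linearZr_LR /= hx.
rewrite geC0_conj// => H.
have {}H : 0 <= r * (r * '[x]) - r * '[x *m D, x] -
    (r * '[x *m D, x] - '[x *m D]) := H.
rewrite -(ler_pM2l r_gt0) -(@ler_pM2l _ 2)//.
rewrite -subr_ge0; apply: (le_trans H).
rewrite -subr_ge0 in nD; rewrite -subr_ge0; apply: (le_trans nD).
by rewrite le_eqVlt; apply/orP; left; apply/eqP; ring.
Qed.

End Hermitian.

(** * Spectral theorem, min-max bounds and Weyl's inequality for real symmetric matrices *)

Section Spectral.
Local Open Scope sesquilinear_scope.
Local Open Scope complex_scope.
Variable R : realType.

Local Notation "''[' u , v ]" := (dotmx u v) : ring_scope.
Local Notation "''[' u ]" := '[u, u] : ring_scope.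
Local Notation cpx := (map_mx (real_complex R)).

Lemma conjc_cpx m n (A : 'M[R]_(m, n)) : (cpx A) ^t* = cpx A^T.
Proof.
apply/matrixP => i j; rewrite !mxE; apply: conj_Creal.
by apply/complex_realP; exists (A j i).
Qed.

Lemma cpx_hermitian n (A : 'M[R]_n) : A^T = A -> cpx A \is hermsymmx.
Proof.
move=> As; apply/is_hermitianmxP; rewrite expr0 scale1r.
by rewrite -{1}As -conjc_cpx.
Qed.

(** The complexified matrix is Hermitian, so it is unitarily diagonalizable with a real diagonal.
    That diagonal permutes [eigenvalues A], and reordering the rows of the unitary matrix aligns the
    two. *)
Lemma symmetric_spectral n (A : 'M[R]_n) : A^T = A ->
  exists2 s : n.-tuple R, is_spectrum A (eigenvalues A) /\ eigenvalues A = s &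
  exists2 P : 'M[R[i]]_n, P \is unitarymx &
    cpx A = P ^t* *m diag_mx (\row_j (tnth s j)%:C) *m P.
Proof.
move=> As; have Ah := cpx_hermitian As.
have Dr := hermitian_spectral_diag_real Ah.
have /orthomx_spectralP := hermitian_normalmx Ah.
have := spectral_unitarymx (cpx A).
move: (spectralmx _) (spectral_diag _) Dr => P D Dr Pun AE.
pose t := [tuple complex.Re (D 0 j) | j < n].
have tE : D = \row_j (tnth t j)%:C.
  apply/rowP => j; rewrite !mxE tnth_mktuple RRe_real//.
  exact: (mxOverP Dr).
have chA : char_poly A = \prod_(a <- t) ('X - a%:P).
  apply: (map_poly_inj (real_complex R)); rewrite map_char_poly AE.
  rewrite char_poly_conj ?unitarymx_unit// char_poly_trig ?diag_mx_is_trig//.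
  rewrite rmorph_prod big_tuple; apply: eq_bigr => j _.
  by rewrite rmorphB /= map_polyX map_polyC/= mxE eqxx mulr1n tE mxE.
have spA : is_spectrum A (eigenvalues A).
  (* The sorted diagonal is a witness, so the junk value of [eigenvalues] is not reached. *)
  apply: (@xgetPex _ [::] (is_spectrum A)); exists (sort >=%R t); split.
    by apply: sort_sorted => x y; exact: le_total.
  by rewrite chA; apply: perm_big; rewrite perm_sym perm_sort.
have /tuple_permP[p sp] : perm_eq (eigenvalues A) t.
  by apply: prod_XsubC_eq; rewrite -spA.2.
eexists; first by split => //; exact: sp.
exists (rowsub p P); first exact: rowsub_unitarymx (@perm_inj _ p) Pun.
rewrite AE invmx_unitary//.
apply/matrixP => i j; rewrite !mul_mx_diag !mxE (reindex_inj (@perm_inj _ p)).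
apply: eq_bigr => k _; rewrite !mxE tE !mxE; congr (_ * _%:C * _).
by rewrite !tnth_mktuple.
Qed.

(* The rows of U are eigenvectors of A, for the eigenvalues with indices e i. *)
Lemma spectral_compression n (A : 'M[R]_n) k (e : 'I_k -> 'I_n) :
  A^T = A -> injective e ->
  exists2 U : 'M[R[i]]_(k, n), U \is unitarymx &
    U *m cpx A *m U ^t* = diag_mx (\row_i ((eigenvalues A)`_(e i))%:C).
Proof.
move=> As einj; have [s [_ sE] [P Pun AE]] := symmetric_spectral As.
have PP := unitarymxP Pun.
have UP : rowsub e P *m P ^t* = rowsub e 1%:M by rewrite -PP mul_rowsub_mx.
exists (rowsub e P); first exact: rowsub_unitarymx.
rewrite AE !mulmxA UP -mulmxA.
have -> : P *m rowsub e P ^t* = rowsub e 1%:M ^t*.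
  by rewrite -UP trmxC_mul trmxCK.
apply/matrixP => i j; rewrite mul_rowsub_mx mul1mx.
rewrite !mxE (bigD1 (e j))//= big1 ?addr0; last first.
  by move=> l lj; rewrite !mxE [e j == l]eq_sym (negPf lj) conjC0 mulr0.
rewrite !mxE eqxx conjC1 mulr1 (inj_eq einj) (tnth_nth 0) sE.
by case: eqP => [->|].
Qed.

Lemma size_eigenvalues n (A : 'M[R]_n) : A^T = A -> size (eigenvalues A) = n.
Proof. by move=> /symmetric_spectral[s [_ ->] _]; rewrite size_tuple. Qed.

Lemma eigenvalues_le n (A : 'M[R]_n) i j : A^T = A -> (i <= j < n)%N ->
  (eigenvalues A)`_j <= (eigenvalues A)`_i.
Proof.
move=> As /andP[ij jn].
have [s [[so _] sE] _] := symmetric_spectral As.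
have getr : transitive (>=%R : rel R) by move=> x y z yx xz; exact: le_trans yx.
apply: (sorted_leq_nth getr (@lexx _ R) 0 so) => //.
  by rewrite inE size_eigenvalues// (leq_ltn_trans ij).
by rewrite inE size_eigenvalues.
Qed.

(** [U] spans the eigenvectors of the [k.+1] largest eigenvalues. *)
Lemma quadratic_form_ge n (A : 'M[R]_n) k : A^T = A -> (k < n)%N ->
  exists2 U : 'M[R[i]]_(k.+1, n), \rank U = k.+1 &
  forall x : 'rV_n, (x <= U)%MS ->
    (eigval A k.+1)%:C * '[x] <= '[x *m cpx A, x].
Proof.
move=> As kn; have einj : injective (widen_ord kn).
  by move=> i j /(congr1 val) ij; apply: val_inj.
have [U Un UA] := spectral_compression As einj.
exists U; first exact: mxrank_unitary.
move=> _ /submxP[u ->].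
rewrite (dotmx_compression _ UA) dotmx_unitary// dotmx_normE mulr_sumr.
apply: ler_sum => j _; rewrite ler_wpM2r ?mul_conjC_ge0// mxE lecR /=.
by apply: eigenvalues_le => //=; rewrite -ltnS ltn_ord.
Qed.

(** [U] spans the remaining eigenvectors, from the one numbered [k.+1] onwards. *)
Lemma quadratic_form_le n (A : 'M[R]_n) k : A^T = A -> (k < n)%N ->
  exists2 U : 'M[R[i]]_(n - k, n), \rank U = (n - k)%N &
  forall x : 'rV_n, (x <= U)%MS ->
    '[x *m cpx A, x] <= (eigval A k.+1)%:C * '[x].
Proof.
move=> As kn.
have e_lt (i : 'I_(n - k)) : (k + i < n)%N.
  by rewrite -ltn_subRL.
pose e i := Ordinal (e_lt i).
have einj : injective e.
  by move=> i j /(congr1 val)/= /addnI ij; apply: val_inj.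
have [U Un UA] := spectral_compression As einj.
exists U; first exact: mxrank_unitary.
move=> _ /submxP[u ->].
rewrite (dotmx_compression _ UA) dotmx_unitary// dotmx_normE mulr_sumr.
apply: ler_sum => j _; rewrite ler_wpM2r ?mul_conjC_ge0// mxE lecR /=.
by apply: eigenvalues_le => //=; rewrite leq_addr e_lt.
Qed.

Lemma quadratic_form_le_spectral_norm n (D : 'M[R]_n) (x : 'rV[R[i]]_n) :
  D^T = D -> '[x *m cpx D, x] <= (spectral_norm D)%:C * '[x].
Proof.
move=> Ds; case: n D x Ds => [|n] D x Ds.
  by rewrite [x]thinmx0 !linear0r.
set r := spectral_norm D; have r0 : 0 <= r by exact: sqrtr_ge0.
have SS : (D^T *m D)^T = D^T *m D by rewrite trmx_mul trmxK.
have hD : cpx D ^t* = cpx D by rewrite conjc_cpx Ds.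
(* The squared norm of [x *m D] is a quadratic form in [D^T *m D], bounded on the whole space by its
   largest eigenvalue. *)
have nD : '[x *m cpx D] <= r%:C ^+ 2 * '[x].
  have [U rU UA] := quadratic_form_le SS (ltn0Sn n).
  have /UA : (x <= U)%MS by rewrite submx_full// /row_full rU subn0.
  rewrite map_mxM Ds mulmxA dotmx_mul hD => /le_trans; apply.
  rewrite ler_wpM2r ?dnorm_ge0// -rmorphXn/= lecR.
  rewrite /r /spectral_norm Ds.
  have [/sqr_sqrtr->//|/ltW/le_trans] := leP 0 (eigval (D *m D) 1).
  by apply; exact: sqr_ge0.
by apply: dotmx_hermitian_le nD => //; rewrite ler0c.
Qed.

(** Courant-Fischer argument: by dimension count, the span of the top [k.+1] eigenvectors of [A]
    meets [W] in some nonzero [x], on which the forms of [A], [B] and [A - B] are compared. The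
    choice of [W] gives both bounds below. *)
Lemma eigval_le_perturbed n (A B : 'M[R]_n) k m (W : 'M[R[i]]_(m, n)) (mu : R) :
  A^T = A -> B^T = B -> (k < n)%N -> (n <= k + \rank W)%N ->
  (forall x : 'rV_n, (x <= W)%MS -> '[x *m cpx B, x] <= mu%:C * '[x]) ->
  eigval A k.+1 <= mu + spectral_norm (A - B).
Proof.
move=> As Bs kn rW WB; have [U rU UA] := quadratic_form_ge As kn.
have cap_neq0 : (U :&: W)%MS != 0.
  rewrite -mxrank_eq0 -lt0n; have := mxrank_sum_cap U W; rewrite rU => capE.
  by have := rank_leq_col (U + W)%MS; lia.
have [x] := rowV0Pn cap_neq0; rewrite sub_capmx => /andP[xU xW] x0.
have x_gt0 : 0 < '[x] by rewrite dnorm_gt0.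
have Ds : (A - B)^T = A - B by rewrite linearB /= As Bs.
rewrite -lecR -(ler_pM2r x_gt0); apply: (le_trans (UA _ xU)).
have -> : cpx A = cpx B + cpx (A - B) by rewrite -map_mxD addrC subrK.
rewrite mulmxDr linearDl [(_ + _)%:C]rmorphD mulrDl /= lerD ?WB//.
exact: quadratic_form_le_spectral_norm.
Qed.

Lemma weyl_le n (A B : 'M[R]_n) k : A^T = A -> B^T = B -> (k < n)%N ->
  eigval A k.+1 <= eigval B k.+1 + spectral_norm (A - B).
Proof.
move=> As Bs kn; have [U rU UB] := quadratic_form_le Bs kn.
by apply: (eigval_le_perturbed As Bs kn _ UB); rewrite rU subnKC// ltnW.
Qed.

Lemma eigval_le_dist_rank n (A B : 'M[R]_n) k : A^T = A -> B^T = B ->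
  (k < n)%N -> (\rank B <= k)%N -> eigval A k.+1 <= spectral_norm (A - B).
Proof.
move=> As Bs kn rB; rewrite -[leRHS]add0r.
(* On the kernel of [B] its form vanishes, so [mu = 0] works. *)
apply: (@eigval_le_perturbed _ _ _ _ _ (kermx (cpx B))) => //.
  by rewrite mxrank_ker mxrank_map; lia.
by move=> x /sub_kermxP ->; rewrite linear0l mul0r.
Qed.

(** Writing the columns in a basis of their span factors [A] through that dimension. *)
Lemma mxrank_le_dim_col_span m n (A : 'M[R]_(m, n)) :
  (\rank A <= \dim (col_span A))%N.
Proof.
pose b := vbasis (col_span A).
pose Bm : 'M[R]_(m, _) := \matrix_(i < m, j < \dim (col_span A)) b`_j i 0.
pose Cm := \matrix_(i < \dim (col_span A), j < n) coord b i (col j A).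
suff AE : A = Bm *m Cm by rewrite {1}AE mulmx_max_rank.
apply/matrixP => i j; rewrite mxE.
have /coord_vbasis/(congr1 (fun v : 'cV_m => v i 0)) : col j A \in col_span A.
  by apply: memv_span; apply: map_f; rewrite mem_enum.
rewrite mxE summxE => ->; apply: eq_bigr => l _; rewrite !mxE mulrC //.
Qed.

End Spectral.

(** * Measurability of the spectral norm *)

Section MeasurableSpectralNorm.
Context d (T : measurableType d) (R : realType).

(* Descartes' rule of signs for a polynomial all of whose roots are real. *)
Lemma prod_XsubC_coef_ge0P (s : seq R) :
  (forall k, 0 <= (\prod_(a <- s) ('X - a%:P))`_k) <->
  (forall a, a \in s -> a <= 0).
Proof.
split=> [p_ge0 a a_s|s_le0]; last first.
  rewrite big_seq; apply: (big_ind (fun p : {poly R} => forall k, 0 <= p`_k))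
    => [k|p q p0 q0 k|a /s_le0 a0 k].
  - by rewrite coef1 ler0n.
  - by rewrite coefM sumr_ge0// => j _; rewrite mulr_ge0.
  - rewrite coefB coefX coefC; case: k => [|[|k]] /=; rewrite ?subr0//.
    by rewrite sub0r oppr_ge0.
(* A monic polynomial with nonnegative coefficients is at least [a ^+ size s > 0] at a positive [a],
   so [a] cannot be a root. *)
rewrite leNgt; apply/negP => a_gt0.
set p := \prod_(_ <- _) _ in p_ge0.
have : root p a by rewrite root_prod_XsubC.
have p_size : size p = (size s).+1 by rewrite size_prod_XsubC.
have p_lead : p`_(size s) = 1.
  have /monicP := monic_prod_XsubC s xpredT id.
  by rewrite lead_coefE -/p p_size.
rewrite /root horner_coef p_size big_ord_recr /= p_lead mul1r gt_eqF//.
rewrite ltr_wpDl ?exprn_gt0// sumr_ge0// => j _.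
by rewrite mulr_ge0 ?exprn_ge0// ltW.
Qed.

Lemma char_poly_shift n (A : 'M[R]_n) (a : R) :
  char_poly (A - a%:M) = char_poly A \Po ('X + a%:P).
Proof.
rewrite /char_poly -(det_map_mx (comp_poly ('X + a%:P))); congr (\det _).
apply/matrixP => i j; rewrite !mxE [RHS]rmorphB rmorphMn /=.
rewrite comp_polyC comp_polyX polyCB polyCMn mulrnDl opprB addrA; ring.
Qed.

(** The roots of the shifted characteristic polynomial are the eigenvalues minus [a], so the sign
    rule applies. A positive dimension ensures that [eigval A 1] is an eigenvalue and not the
    default 0. *)
Lemma eigval1_leP n (A : 'M[R]_n.+1) (a : R) : A^T = A ->
  eigval A 1 <= a <-> (forall k, 0 <= (char_poly (A - a%:M))`_k).
Proof.
move=> As; have [s [[so chA] sE] _] := symmetric_spectral As.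
rewrite char_poly_shift chA rmorph_prod /=.
under eq_bigr do
  rewrite rmorphB /= comp_polyX comp_polyC -addrA -polyCB -opprB polyCN.
rewrite -(big_map (fun x => x - a) xpredT (fun x => 'X - x%:P)).
rewrite prod_XsubC_coef_ge0P /eigval /=; split=> [s0a _ /mapP[x xs ->]|H].
  rewrite subr_le0 (le_trans _ s0a)//; move: (xs) => /(nthP 0)[i ilt <-].
  by apply: eigenvalues_le => //; rewrite size_eigenvalues in ilt.
rewrite -subr_le0; apply: H; apply: map_f.
by apply: mem_nth; rewrite size_eigenvalues.
Qed.

Lemma measurable_coef_prod (I : eqType) (s : seq I) (F : I -> T -> {poly R}) :
  (forall i k, measurable_fun setT (fun w => (F i w)`_k)) ->
  forall k, measurable_fun setT (fun w => (\prod_(i <- s) F i w)`_k).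
Proof.
move=> mF; elim: s => [|i s ih] k.
  by under eq_fun do rewrite big_nil; exact: measurable_cst.
under eq_fun do rewrite big_cons coefM.
by apply: measurable_sum => j; exact: measurable_funM.
Qed.

Lemma measurable_coef_char_poly n (A : T -> 'M[R]_n) :
  (forall i j, measurable_fun setT (fun w => A w i j)) ->
  forall k, measurable_fun setT (fun w => (char_poly (A w))`_k).
Proof.
move=> mA k; under eq_fun do rewrite /char_poly /determinant coef_sum.
apply: measurable_sum => s.
have mP : measurable_fun setT
    (fun w => (\prod_i (char_poly_mx (A w)) i (s i))`_k).
  apply: measurable_coef_prod => i l.
  under eq_fun do rewrite !mxE coefB coefMn coefX coefC.
  apply: measurable_funB; first exact: measurable_cst.
  by case: l => [|l] /=; [exact: mA|exact: measurable_cst].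
under eq_fun do rewrite mulr_sign.
by case: odd_perm => //; under eq_fun do rewrite coefN; exact: measurable_funN.
Qed.

Lemma measurable_eigval1 n (A : T -> 'M[R]_n.+1) :
  (forall w, (A w)^T = A w) ->
  (forall i j, measurable_fun setT (fun w => A w i j)) ->
  measurable_fun setT (fun w => eigval (A w) 1).
Proof.
move=> As mA mT; apply: (measurability _ (RGenOInfty.measurableE R)) => //.
move=> /= _ [_ [a ->] <-]; rewrite setTI preimage_itvoy.
rewrite [X in measurable X](_ : _ =
    ~` \bigcap_k [set w | 0 <= (char_poly (A w - a%:M))`_k]).
  apply: measurableC; apply: bigcapT_measurable => k.
  rewrite -[X in measurable X]setTI; rewrite -preimage_itvcy.
  apply: measurable_coef_char_poly => // i j.
  under eq_fun do rewrite !mxE.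
  by apply: measurable_funB => //; exact: measurable_cst.
apply/seteqP; split=> w /=; rewrite ltNge.
  by move=> /negP Aa H; apply: Aa; apply/eigval1_leP => // k; exact: H.
move=> H; apply/negP => /eigval1_leP Aa; apply: H => k _.
exact: Aa.
Qed.

Lemma measurable_spectral_norm n (A : T -> 'M[R]_n) :
  (forall i j, measurable_fun setT (fun w => A w i j)) ->
  measurable_fun setT (fun w => spectral_norm (A w)).
Proof.
case: n A => [|n] A mA.
  rewrite (_ : (fun _ => _) = cst (spectral_norm (0 : 'M[R]_0))).
    exact: measurable_cst.
  by apply/funext => w; rewrite [A w]thinmx0.
have msqrt : measurable_fun setT (@Num.sqrt R).
  by apply: continuous_measurable_fun; exact: sqrt_continuous.
apply: (measurableT_comp msqrt).
apply: measurable_eigval1 => [w|i j]; first by rewrite trmx_mul trmxK.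
under eq_fun do rewrite mxE.
apply: measurable_sum => k; under eq_fun do rewrite mxE.
exact: measurable_funM.
Qed.

End MeasurableSpectralNorm.

(** * Logarithm inequalities and the deterministic analysis of the criterion *)

Section Criterion.
Variable R : realType.

Lemma ln1D_ge_sub_sqr (x : R) : 0 <= x -> x - x ^+ 2 <= ln (1 + x).
Proof.
move=> x0; have x1 : 0 < 1 + x by lra.
(* [- ln (1 + x) = ln (1 - y) <= - y] *)
pose y := x / (1 + x).
have yE : 1 + - y = (1 + x)^-1 by rewrite /y; field; rewrite gt_eqF.
have Vx : 0 < (1 + x)^-1 by rewrite invr_gt0.
have : ln (1 + - y) <= - y by apply: le_ln1Dx; lra.
rewrite yE lnV ?posrE// lerN2; apply: le_trans.
(* Here [(x - x ^+ 2) * (1 + x) = x - x ^+ 3], which is at most [x]. *)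
by rewrite /y ler_pdivlMr//; nra.
Qed.

Lemma sub_ln1D_gt0 (x : R) : 0 < x -> 0 < x - ln (1 + x).
Proof.
move=> x0; rewrite subr_gt0 -[ltRHS]expRK ltr_ln ?posrE ?expR_gt0//; last lra.
by rewrite expR_gt1Dx// gt_eqF.
Qed.

Lemma sub_ln1D_le (x y : R) : 0 <= x -> x <= y ->
  x - ln (1 + x) <= y - ln (1 + y).
Proof.
move=> x0 xy; have x1 : 0 < 1 + x by lra.
(* Chosen so that [1 + t] is the ratio of [1 + y] to [1 + x]; then the logarithm grows by
   [ln (1 + t) <= t <= y - x]. *)
pose t := (y - x) / (1 + x).
have t0 : 0 <= t by rewrite divr_ge0 ?subr_ge0// ltW.
have -> : 1 + y = (1 + x) * (1 + t) by rewrite /t; field; rewrite gt_eqF.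
have t1 : 0 < 1 + t by lra.
rewrite lnM ?posrE//.
have : ln (1 + t) <= t by apply: le_ln1Dx; lra.
have : t <= y - x by rewrite /t ler_pdivrMr//; nra.
lra.
Qed.

(** Positive entries form a prefix of a decreasing list; past its end the default 0 is not positive,
    so [i] needs no bound. *)
Lemma count_gt0_sorted (s : seq R) i : sorted >=%R s ->
  (i < count (fun a => 0 < a)%R s)%N = (0 < s`_i).
Proof.
elim: s i => [|x s ih] i /=; first by rewrite nth_nil ltxx.
have getr : transitive (>=%R : rel R) by move=> a b c ba ac; exact: le_trans ba.
rewrite (path_sortedE getr) => /andP[/allP xs so].
have [x0|x0] := ltP 0 x; first by case: i => [//|i]; rewrite add1n ltnS ih.
have s0 a : a \in s -> a <= 0 by move=> /xs /le_trans; apply.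
rewrite add0n (_ : count _ _ = 0%N); last first.
  apply/eqP; rewrite -leqn0 leqNgt -has_count -all_predC.
  by apply/allP => a /s0; rewrite /= -leNgt.
case: i => [|i] /=; first by rewrite ltNge x0.
have [ilt|ige] := ltnP i (size s); last by rewrite nth_default// ltxx.
by rewrite ltNge s0// mem_nth.
Qed.

Lemma num_pos_eigvalP n (A : 'M[R]_n) i : A^T = A ->
  (i < num_pos_eigval A)%N = (0 < eigval A i.+1).
Proof.
by move=> /symmetric_spectral[s [[so _] _] _]; rewrite count_gt0_sorted.
Qed.

Lemma eigval_le n (A : 'M[R]_n) i j :
  A^T = A -> (1 <= i <= j)%N -> (j <= n)%N -> eigval A j <= eigval A i.
Proof. by move=> As ij jn; apply: eigenvalues_le => //; lia. Qed.

(** Comparison with the single neighbour [k - 1] suffices. *)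
Lemma nearest_integer_le (x : R) k : nearest_integer x k -> k%:R <= x + 2^-1.
Proof.
move=> /(_ (k%:Z - 1)); rewrite rmorphB /= -pmulrn.
by have [h|h] := leP x (k%:R - 1); do 2?[case: ger0P => ?|case: ler0P=> ?]; lra.
Qed.

(** The deterministic core: [delta] stands for the estimation error and [lam] for a lower bound on
    the [L]-th estimated eigenvalue. Any [l] other than [L] would make the criterion strictly
    smaller than at [L]. *)
Lemma maximizer_criterion_eq (T K Kc : nat) (C c delta lam : R)
    (A : 'M[R]_K) (L l : nat) :
  A^T = A -> (1 <= L <= Kc)%N -> (Kc <= K)%N -> 0 < C ->
  Kc%:R <= c * K%:R + 2^-1 ->
  0 < lam -> lam <= eigval A L ->
  ((L < Kc)%N -> eigval A L.+1 <= delta) ->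
  C * K%:R < T%:R / 2 * (lam - ln (1 + lam)) ->
  T%:R * delta ^+ 2 < 2 * (1 - c) * (C * K%:R) ->
  is_maximizer Kc (criterion T Kc C A) l -> l = L.
Proof.
move=> As /andP[L1 LKc] KcK C0 Kcc lam0 lamL eL CT Td [/andP[l1 lKc] Gmax].
have := Gmax L; rewrite L1 LKc => /(_ isT).
have T0 : 0 <= T%:R :> R by [].
(* Hence the minimum of [tau] and [L] in the criterion is [L]. *)
have Ltau : (L <= num_pos_eigval A)%N.
  rewrite -(prednK L1) num_pos_eigvalP// prednK//.
  exact: lt_le_trans lamL.
pose g i : R := ln (eigval A i + 1) - eigval A i.
have LK : (L%:R : R) <= Kc%:R by rewrite ler_nat.
have lK : (l%:R : R) <= Kc%:R by rewrite ler_nat.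
have L1R : 1 <= L%:R :> R by rewrite ler1n.
have l1R : 1 <= l%:R :> R by rewrite ler1n.
rewrite /criterion (minn_idPr Ltau) -/g !add1n.
have [lL|Ll|//] := ltngtP l L => GLl; exfalso.
- have lLR : l%:R < L%:R :> R by rewrite ltr_nat.
  move: GLl; rewrite (minn_idPr (leq_trans (ltnW lL) Ltau)).
  rewrite (@big_cat_nat _ _ _ L.+1 l.+1)/=;
    [|by rewrite ltnS ltnW|by rewrite ltnS].
  set S := \sum_(L.+1 <= i < _) _; set S' := \sum_(_ <= i < _) _.
  have S'le : S' <= - (lam - ln (1 + lam)) * (L%:R - l%:R).
    rewrite -natrB; last exact: ltnW.
    rewrite mulr_natr -subSS -sumr_const_nat.
    apply: ler_sum_nat => i /andP[li iL].
    have : lam <= eigval A i.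
      apply: (le_trans lamL); apply: eigval_le => //.
        by rewrite (leq_trans _ li).
      by rewrite (leq_trans _ (leq_trans LKc KcK)).
    by move=> /(sub_ln1D_le (ltW lam0)); rewrite [1 + eigval A i]addrC; lra.
  have T2 : 0 <= T%:R / 2 :> R by rewrite divr_ge0.
  have := ler_wpM2l T2 S'le.
  move: CT; set eta := lam - _; set T' := T%:R / 2 => CT H1.
  have H2 : 0 < (L%:R - l%:R) * (T' * eta - C * K%:R).
    by rewrite mulr_gt0 ?subr_gt0.
  (* The penalties at [L] and [l] differ by [(L - l) * C * K] minus half of this quantity, hence by
     at most [(L - l) * C * K]. *)
  have H3 : 0 <= C * ((L%:R - l%:R) * (L%:R + l%:R - 1)).
    by rewrite mulr_ge0 ?ltW// mulr_gt0 ?subr_gt0//; lra.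
  by move: H1 H2 H3; lra.
- have LlR : L%:R < l%:R :> R by rewrite ltr_nat.
  move: GLl; set m := minn _ _.
  have mL : (L <= m)%N by rewrite leq_min Ltau ltnW.
  have ml : (m <= l)%N by rewrite geq_minr.
  rewrite (@big_cat_nat _ _ _ m.+1 L.+1)/=;
    [|by []|by rewrite ltnS (leq_trans ml)].
  set S := \sum_(m.+1 <= i < _) _; set S' := \sum_(_ <= i < _) _.
  (* The sums differ only at indices [L + 1] to [m], where the eigenvalues are positive and at most
     [delta]; there are at most [l - L] of them. *)
  have S'ge : - delta ^+ 2 * (l%:R - L%:R) <= S'.
    apply: (@le_trans _ _ (- delta ^+ 2 * (m%:R - L%:R))).
      by rewrite !mulNr lerN2 ler_wpM2l ?sqr_ge0// lerD2r ler_nat.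
    rewrite -natrB// mulr_natr -subSS -sumr_const_nat.
    apply: ler_sum_nat => i /andP[Li im].
    have ei0 : 0 < eigval A i.
      case: i Li im => // i Li im; rewrite -num_pos_eigvalP//.
      by move: im; rewrite ltnS /m leq_min => /andP[].
    have eid : eigval A i <= delta.
      apply: (@le_trans _ _ (eigval A L.+1)); last first.
        exact/eL/(leq_trans Ll).
      apply: eigval_le => //.
      by rewrite (leq_trans _ (leq_trans lKc KcK))// -ltnS (leq_trans im).
    have := ln1D_ge_sub_sqr (ltW ei0); rewrite [1 + _]addrC.
    have : eigval A i ^+ 2 <= delta ^+ 2.
      by rewrite ler_pXn2r// nnegrE ltW// (lt_le_trans ei0).
    lra.
  (* Both [l] and [L] are at most [c * K + 1/2]; the two rounding halves are absorbed by the
     [+ 1]. *)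
  have Kl : 2 * (1 - c) * K%:R <= 2 * K%:R - l%:R - L%:R + 1 by lra.
  have T2 : 0 <= T%:R / 2 :> R by rewrite divr_ge0.
  have H1 := ler_wpM2l T2 S'ge.
  have lL0 : 0 < l%:R - L%:R :> R by rewrite subr_gt0.
  have H2 : 0 < (l%:R - L%:R) *
      (2 * (1 - c) * (C * K%:R) - T%:R * delta ^+ 2).
    by rewrite mulr_gt0 ?subr_gt0.
  have H3 := ler_wpM2l (ltW (mulr_gt0 C0 lL0)) Kl.
  by move: H1 H2 H3; lra.
Qed.

End Criterion.

Lemma spectral_normN (R : realType) n (A : 'M[R]_n) :
  spectral_norm (- A) = spectral_norm A.
Proof. by rewrite /spectral_norm mulmxN [(- A)^T]linearN mulNmx opprK. Qed.

(** * Deviation events and the union bound *)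

Section ConvergenceInProbability.
Context d (Omega : measurableType d) (R : realType) (P : probability Omega R).

Lemma measurable_deviation (X : Omega -> R) (x eps : R) :
  measurable_fun setT X -> measurable [set w | eps < `|X w - x|].
Proof.
move=> mX; rewrite -[X in measurable X]setTI -preimage_itvoy.
have mN : measurable_fun setT (fun w => `|X w - x|).
  apply: measurableT_comp; first exact: normr_measurable.
  by apply: measurable_funB => //; exact: measurable_cst.
by apply: mN.
Qed.

Lemma cvg_probability0_subU (A B C : nat -> set Omega) :
  (forall n, measurable (A n)) -> (forall n, measurable (B n)) ->
  (forall n, measurable (C n)) ->
  (\forall n \near \oo, A n `<=` B n `|` C n) ->
  (fun n => P (B n)) @ \oo --> 0%E -> (fun n => P (C n)) @ \oo --> 0%E ->
  (fun n => P (A n)) @ \oo --> 0%E.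
Proof.
move=> mA mB mC ABC PB PC.
have PBC : (P (B n) + P (C n))%E @[n --> \oo] --> 0%E.
  by rewrite -[X in _ --> X]adde0; apply: cvgeD.
apply: squeeze_cvge (cvg_cst 0%E) PBC; near=> n.
rewrite measure_ge0 /=.
apply: le_trans (measureU2 _ (mB n) (mC n)).
apply: le_measure; rewrite ?inE//; first exact: measurableU.
by near: n.
Unshelve. all: by end_near. Qed.

End ConvergenceInProbability.

(** * Consistency of the maximizer *)

Theorem theorem5 (R : realType) (d : measure_display)
    (Omega : measurableType d) (P : probability Omega R)
    (* L is fixed; K, K_c and C depend on the sample size T *)
    (L : nat) (K Kc : nat -> nat) (c : R) (C : nat -> R)
    (* response and factor series *)
    (y : nat -> Omega -> R) (f : forall T : nat, nat -> Omega -> 'cV[R]_(K T))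
    (M : forall T : nat, 'M[R]_(K T))
    (Mhat : forall T : nat, Omega -> 'M[R]_(K T))
    (Lhat : nat -> Omega -> nat)
    (y_rv : forall t, measurable_fun setT (y t))
    (f_rv : forall T t i, measurable_fun setT (fun w => f T t w i 0))
    (L_ge1 : (1 <= L)%N)
    (M_psd : forall T, psd (M T))
    (M_central : forall T t,
       central_subspace P (y t.+1) (f T t) (col_span (M T)))
    (M_dim : forall T, \dim (col_span (M T)) = L)
    (* lambda_L > 0, uniformly along the sequence *)
    (M_eig : exists2 lam : R, 0 < lam & forall T, lam <= eigval (M T) L)
    (Mhat_rv : forall T i j, measurable_fun setT (fun w => Mhat T w i j))
    (Mhat_sym : forall T w, (Mhat T w)^T = Mhat T w)
    (c_gt0 : 0 < c) (c_lt1 : c < 1)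
    (Kc_nearest : forall T, nearest_integer (c * (K T)%:R) (Kc T))
    (L_le_Kc : forall T, (L <= Kc T)%N)
    (C_gt0 : forall T, 0 < C T)
    (Lhat_rv : forall T, measurable_fun setT (Lhat T))
    (Lhat_max : forall T w,
       is_maximizer (Kc T) (criterion T (Kc T) (C T) (Mhat T w)) (Lhat T w))
    (Mhat_consistent :
       oP P (fun T w => spectral_norm (Mhat T w - M T)) (fun=> 1))
    (C_rate : (fun T => C T * (K T)%:R / T%:R) @ \oo --> (0 : R))
    (Mhat_rate :
       oP P (fun T w => spectral_norm (Mhat T w - M T) ^+ 2)
            (fun T => C T * (K T)%:R / T%:R)) :
  cvg_in_prob P (fun T w => (Lhat T w)%:R) L%:R.
Proof.
have [lam lam0 lamL] := M_eig.
(* Otherwise [Kc T] would be at least [K T + 1], too far from [c * K T]. Thus every index up to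
   [Kc T] numbers an actual eigenvalue. *)
have KcK T : (Kc T <= K T)%N.
  rewrite leqNgt; apply/negP; rewrite -(ler_nat R) -natr1 => KKc.
  have := nearest_integer_le (Kc_nearest T).
  have : c * (K T)%:R <= (K T)%:R by rewrite ler_piMl// ltW.
  lra.
have Msym T : (M T)^T = M T by case: (M_psd T).
pose a T := C T * (K T)%:R / T%:R.
(* An error of at most [lam / 2] leaves the [L]-th estimated eigenvalue at least [e1]; [eta] is then
   the gain per index. *)
pose e1 := lam / 2; pose eta := e1 - ln (1 + e1).
have e1_gt0 : 0 < e1 by rewrite /e1; lra.
have eta_gt0 : 0 < eta by exact: sub_ln1D_gt0.
have c1_gt0 : 0 < 1 - c by lra.
have mnorm T : measurable_fun setT (fun w => spectral_norm (Mhat T w - M T)).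
  apply: measurable_spectral_norm => i j; under eq_fun do rewrite !mxE.
  by apply: measurable_funB => //; exact: measurable_cst.
move=> eps eps0.
(* The bad events are an error above [e1] and a squared error above [1 - c] times the rate. *)
apply: cvg_probability0_subU (Mhat_consistent _ e1_gt0) (Mhat_rate _ c1_gt0).
- move=> T.
  rewrite [X in measurable X](_ : _ =
      setT `&` Lhat T @^-1` [set n | eps < `|n%:R - L%:R|]).
    exact: Lhat_rv.
  by rewrite setTI.
- move=> T; apply: measurable_deviation.
  by apply: measurable_funM => //; exact: measurable_cst.
- move=> T; apply: measurable_deviation.
  by apply: measurable_funM; [exact: measurable_funX|exact: measurable_cst].
have : \forall T \near \oo, a T < eta / 2.
  by apply: (cvgr_lt 0 C_rate); rewrite divr_gt0.
apply: filter_app; near=> T => aT w /= Ldev.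
have T_gt0 : (0 < T)%N by near: T; exact: nbhs_infty_gt.
have [?|d1] := ltP e1 `|spectral_norm (Mhat T w - M T) / 1 - 0|; first by left.
have [?|d2] := ltP (1 - c) `|spectral_norm (Mhat T w - M T) ^+ 2 / a T - 0|.
  by right.
(* Off both bad events the estimator equals [L] exactly, which rules out a deviation above any
   positive [eps]. *)
exfalso; move: Ldev; suff -> : Lhat T w = L by rewrite subrr normr0; lra.
have T0 : 0 < T%:R :> R by rewrite ltr0n.
have LK : (L <= K T)%N by exact: leq_trans (KcK T).
have K0 : 0 < (K T)%:R :> R by rewrite ltr0n (leq_trans L_ge1).
have CK0 : 0 < C T * (K T)%:R by rewrite mulr_gt0.
have a0 : 0 < a T by rewrite divr_gt0.
have d0 : 0 <= spectral_norm (Mhat T w - M T) by exact: sqrtr_ge0.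
move: d1 d2; rewrite divr1 !subr0 !ger0_norm//; last first.
  by rewrite divr_ge0 ?sqr_ge0// ltW.
rewrite ler_pdivrMr// => d1 d2.
apply: (maximizer_criterion_eq (delta := spectral_norm (Mhat T w - M T))
  (Mhat_sym T w) _ (KcK T) (C_gt0 T) _ e1_gt0 _ _ _ _ (Lhat_max T w)).
- by rewrite L_ge1 L_le_Kc.
- exact: nearest_integer_le (Kc_nearest T).
- have /(weyl_le (Msym T) (Mhat_sym T w)) : (L.-1 < K T)%N by rewrite prednK.
  rewrite prednK// -opprB spectral_normN.
  by have := lamL T; move: d1; rewrite /e1; lra.
- move=> LKc; apply: eigval_le_dist_rank => //.
    exact: leq_trans (KcK T).
  by rewrite -(M_dim T) mxrank_le_dim_col_span.
- move: aT; rewrite /a ltr_pdivrMr// -/eta.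
  by rewrite -[T%:R / 2 * _]mulrA [_^-1 * _]mulrC [T%:R * _]mulrC.
(* The threshold [1 - c] is half of what the criterion tolerates, which yields the strict
   inequality. *)
- apply: (@le_lt_trans _ _ ((1 - c) * (C T * (K T)%:R))).
    have -> : (1 - c) * (C T * (K T)%:R) = T%:R * ((1 - c) * a T).
      by rewrite /a; field; rewrite gt_eqF.
    by rewrite ler_pM2l.
  by rewrite -[2 * _ * _]mulrA ltr_pMl ?mulr_gt0// ltr1n.
Unshelve. all: by end_near. Qed.
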